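(* Let $N,M\ge1$ and, for $0\le j\le N$, let $\mathbf A_j=\mathbf A_j(\mathbf k_j)$ be a continuous $M\times M$ complex matrix-valued function of $\mathbf k_j=(k_{j+1},\dots,k_N)\in[0,1]^{N-j}$. Let $\mathbf F_j=\mathbf F_j(\lambda,\mathbf k_j)$ and $\mathbf G_j=\mathbf G_j(\lambda,\mathbf k_j)$ be defined by $$\mathbf F_0=\mathbf A_0-\lambda\mathbf I,\qquad \mathbf F_j=\mathbf A_j+\langle\mathbf F_{j-1}^{-1}\rangle_j^{-1}\quad(1\le j\le N),$$ $$\mathbf G_0=\mathbf F_0,\qquad \mathbf G_j=\langle\mathbf F_{j-1}^{-1}\rangle_j\mathbf F_j=\mathbf I+\langle\mathbf F_{j-1}^{-1}\rangle_j\mathbf A_j\quad(1\le j\le N),$$ for $\lambda\in\mathbb C$ such that all inverses occurring in these definitions exist. Then the following identities hold: $$\mathbf A_0=\lambda\mathbf I+\mathbf G_0,\qquad \mathbf A_j=\left\langle(\mathbf G_0\mathbf G_1\cdots\mathbf G_{j-1})^{-1}\right\rangle_{1,j}^{-1}(\mathbf G_j-\mathbf I),\quad 1\le j\le N,$$ and $$\mathbf A_0=\lambda\mathbf I+\mathbf F_0,\qquad \mathbf A_j=\mathbf F_j-\langle\mathbf F_{j-1}^{-1}\rangle_j^{-1},\quad 1\le j\le N.$$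
   Context: Notation: $\mathbf k=(k_1,\dots,k_N)\in[0,1]^N$, $\mathbf k_j=(k_{j+1},\dots,k_N)$, $\mathbf k_0=\mathbf k$; functions of $\mathbf k_N$ are constants. $\langle\cdot\rangle_{i,j}=\int_{[0,1]^{j-i+1}}\cdot\,dk_i\cdots dk_j$ for $i\le j$, and $\langle\cdot\rangle_i=\int_0^1\cdot\,dk_i$ (entrywise integration of matrices). $\mathbf I$ is the $M\times M$ identity matrix. A power $-1$ always denotes the matrix inverse; $\langle\cdot\rangle_{1,j}^{-1}$ is the inverse of the integrated matrix. ''All inverses exist'' means: for the given $\lambda$ and every $j=1,\dots,N$, the matrix $\mathbf F_{j-1}(\lambda,\mathbf k_{j-1})$ is invertible for all $\mathbf k_{j-1}\in[0,1]^{N-j+1}$ and the matrix $\langle\mathbf F_{j-1}^{-1}\rangle_j(\lambda,\mathbf k_j)$ is invertible for all $\mathbf k_j\in[0,1]^{N-j}$. The identities are between functions of $\mathbf k_j$, for such $\lambda$. *)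

(* Defs.v *)
From HB Require Import structures.
From mathcomp Require Import all_boot all_order all_algebra complex.
From mathcomp Require Import all_classical all_reals all_analysis.

Set Implicit Arguments.
Unset Strict Implicit.
Unset Printing Implicit Defensive.

Import Order.TTheory GRing.Theory Num.Theory.
Import numFieldNormedType.Exports.

Local Open Scope classical_set_scope.
Local Open Scope ring_scope.

Section cons_measure.
Context (R : realType) (d : measure_display) (T : measurableType d) (n : nat).
Variables (nu : {sigma_finite_measure set T -> \bar R})
          (mu : {sigma_finite_measure set (n.-tuple T) -> \bar R}).

Definition cons_pair (x : T * n.-tuple T) : n.+1.-tuple T :=
  [tuple of x.1 :: x.2].

Lemma measurable_cons_pair : measurable_fun [set: T * n.-tuple T] cons_pair.
Proof. exact: measurable_cons. Qed.

Definition cons_measure : set (n.+1.-tuple T) -> \bar R :=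
  pushforward (nu \x mu)%E cons_pair.

Let cons_measure0 : cons_measure set0 = 0%E.
Proof. by apply: measure0; exact: measurable_cons_pair. Qed.

Let cons_measure_ge0 A : (0 <= cons_measure A)%E.
Proof. by apply: measure_ge0; exact: measurable_cons_pair. Qed.

Let cons_measure_sigma_additive : semi_sigma_additive cons_measure.
Proof.
by apply: measure_semi_sigma_additive; exact: measurable_cons_pair.
Qed.

HB.instance Definition _ := isMeasure.Build _ _ _ cons_measure
  cons_measure0 cons_measure_ge0 cons_measure_sigma_additive.

Lemma cons_measure_sigma_finite : sigma_finite setT cons_measure.
Proof.
have /sigma_finiteP[F [TF ndF Foo]] := sigma_finiteT nu.
have /sigma_finiteP[G [TG ndG Goo]] := sigma_finiteT mu.
exists (fun i => [set v | F i (thead v) /\ G i [tuple of behead v]]).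
  apply/seteqP; split=> // v _.
  have [i _ Fi] : (\bigcup_i F i) (thead v) by rewrite -TF.
  have [k _ Gk] : (\bigcup_k G k) [tuple of behead v] by rewrite -TG.
  exists (maxn i k) => //; split.
    by move: Fi; exact/subsetPset/ndF/leq_maxl.
  by move: Gk; exact/subsetPset/ndG/leq_maxr.
move=> i; have [mFi Fi] := Foo i; have [mGi Gi] := Goo i; split.
  apply: measurableI.
    by rewrite -[X in measurable X]setTI; exact: measurable_tnth.
  by rewrite -[X in measurable X]setTI; exact: measurable_behead.
rewrite /cons_measure /pushforward.
have -> : cons_pair @^-1` [set v | F i (thead v) /\ G i [tuple of behead v]]
    = F i `*` G i.
  apply/seteqP; split=> -[x v] /= [Fx Gv]; split=> //=.
    by move: Gv; congr (G i); apply/val_inj.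
  by move: Gv; congr (G i); apply/val_inj.
by rewrite product_measure1E// lte_mul_pinfty// ge0_fin_numE.
Qed.

HB.instance Definition _ := Measure_isSigmaFinite.Build _ _ _ cons_measure
  cons_measure_sigma_finite.
End cons_measure.

Fixpoint power_measure (R : realType) (d : measure_display)
    (T : measurableType d) (nu : {sigma_finite_measure set T -> \bar R})
    (n : nat) : {sigma_finite_measure set (n.-tuple T) -> \bar R} :=
  match n with
  | 0 => \d_ [tuple]
  | n'.+1 => cons_measure nu (power_measure nu n')
  end.

Section matrix_integral.
Context (R : realType).
Local Notation C := R[i].

Definition complex_integral d (T : measurableType d)
    (mu : {measure set T -> \bar R}) (D : set T) (f : T -> C) : C :=
  Complex (\int[mu]_(x in D) complex.Re (f x))
          (\int[mu]_(x in D) complex.Im (f x)).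

Definition matrix_integral d (T : measurableType d)
    (mu : {measure set T -> \bar R}) (D : set T) M (f : T -> 'M[C]_M) : 'M[C]_M :=
  \matrix_(a, b) complex_integral mu D (fun x => f x a b).

Definition cube n : set 'rV[R]_n := [set k | forall i, k ord0 i \in `[0, 1]].

Definition cube_tuple n : set (n.-tuple (measurableTypeR R)) :=
  [set u | forall i, (tnth u i : R) \in `[0, 1]].

(* Intended for [q = n + p]; [conform_mx] avoids carrying that equation. *)
Definition cat_row n p q (u : 'rV[R]_n) (v : 'rV[R]_p) : 'rV[R]_q :=
  conform_mx 0 (row_mx u v).

Lemma ltn_drop N j (l : 'I_(N - j)) : (j + l < N)%N.
Proof. by rewrite -ltn_subRL. Qed.

Definition drop_row N j (k : 'rV[R]_N) : 'rV[R]_(N - j) :=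
  \row_l k ord0 (Ordinal (ltn_drop l)).

End matrix_integral.

(* The variables k_(j+1), ..., k_N are the entries of a row of length [N - j],
   and a function of them is a function on ['rV_(N - j)] whose values off the
   cube are irrelevant. *)
Section continued_fraction.
Context (R : realType) (N M : nat).
Local Notation C := R[i].
Local Notation fun_from j := ('rV[R]_(N - j) -> 'M[C]_M).

(* [int_next f] integrates out k_(j+1). *)
Definition int_next j (f : fun_from j) : fun_from j.+1 := fun k =>
  matrix_integral (@lebesgue_measure R) `[0, 1]
    (fun t : measurableTypeR R => f (cat_row (N - j) (const_mx t : 'rV_1) k)).

(* [int_first f] integrates out k_1, ..., k_j. *)
Definition int_first j (f : 'rV[R]_N -> 'M[C]_M) : fun_from j := fun k =>
  matrix_integral (power_measure (@lebesgue_measure R) j) (@cube_tuple R j)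
    (fun u => f (cat_row N (\row_(i < j) (tnth u i : R)) k)).

Variables (A : forall j, fun_from j) (lambda : C).

Fixpoint Fseq j : fun_from j :=
  match j with
  | 0 => fun k => A k - lambda%:M
  | i.+1 => fun k => A k + invmx (int_next (fun k' => invmx (Fseq k')) k)
  end.

Definition Gseq j : fun_from j :=
  match j with
  | 0 => fun k => Fseq k
  | i.+1 => fun k => int_next (fun k' => invmx (Fseq k')) k *m Fseq k
  end.

(* G_0 G_1 ... G_(j-1), in this order *)
Definition prodG j (k : 'rV[R]_N) : 'M[C]_M :=
  \big[mulmx/1%:M]_(i < j) Gseq (drop_row i k).

Definition inverses_exist : Prop := forall j, (j < N)%N ->
  (forall k, cube k -> @Fseq j k \in unitmx) /\
  (forall k, cube k -> int_next (fun k' => invmx (@Fseq j k')) k \in unitmx).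

Lemma GseqS_alt j (k : 'rV[R]_(N - j.+1)) :
    int_next (fun k' => invmx (@Fseq j k')) k \in unitmx ->
  Gseq k = 1%:M + int_next (fun k' => invmx (@Fseq j k')) k *m A k.
Proof. by move=> H; rewrite /= mulmxDr mulmxV// addrC. Qed.

End continued_fraction.

Arguments Fseq {R N M} A lambda j k.
Arguments Gseq {R N M} A lambda j k.
Arguments cube {R} n k.

(* Main.v *)
(** The identities with the F_j are rearrangements of the recursion, and so is
    A_j = <F_(j-1)^-1>_j^-1 (G_j - I).  The point is therefore

      <(G_0 ... G_(j-1))^-1>_{1,j} = <F_(j-1)^-1>_j.

    Of the factors of (F_i G_(i+1) ... G_j)^-1 only F_i^-1 depends on k_(i+1),
    and G_(i+1)^-1 <F_i^-1>_(i+1) = F_(i+1)^-1; so integrating out k_(i+1) gives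
    (F_(i+1) G_(i+2) ... G_j)^-1, and this is iterated from i = 0.  Fubini's
    theorem applies because every F_j is continuous, hence bounded, on the
    cube. *)
Require Import Defs.
From mathcomp Require Import all_boot all_order all_algebra complex.
From mathcomp Require Import all_classical all_reals all_analysis.
From mathcomp Require Import measurable_realfun zify.

Import Order.TTheory GRing.Theory Num.Theory.
Import numFieldNormedType.Exports.

Local Open Scope classical_set_scope.
Local Open Scope ring_scope.

Set Implicit Arguments.
Unset Strict Implicit.
Unset Printing Implicit Defensive.

(** * Fubini on the cube *)

Section cons_fubini.
Context (R : realType) (d : measure_display) (T : measurableType d) (n : nat).
Variables (nu : {sigma_finite_measure set T -> \bar R})
          (mu : {sigma_finite_measure set (n.-tuple T) -> \bar R}).

(** Change of variables along [cons_pair], then Fubini with the head as the inner variable.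
    Integrability is asked of every slice over [E], not of almost every one, because the inner
    [Rintegral] sends an infinite value to 0. *)
Lemma Rintegral_cons_measure (D : set T) (E : set (n.-tuple T))
    (S : set (n.+1.-tuple T)) (f : n.+1.-tuple T -> R) :
  measurable D -> measurable E -> measurable S ->
  @cons_pair _ T n @^-1` S = D `*` E ->
  measurable_fun setT f ->
  (nu \x mu)%E.-integrable (D `*` E) (EFin \o (f \o @cons_pair _ T n)) ->
  (forall v, E v -> nu.-integrable D (EFin \o (fun x => f [tuple of x :: v]))) ->
  \int[cons_measure nu mu]_(u in S) f u =
  \int[mu]_(v in E) \int[nu]_(x in D) f [tuple of x :: v].
Proof.
move=> mD mE mS SDE mf fint fxint.
rewrite /Rintegral.
have mDE : measurable (D `*` E) by exact: measurableX.
have -> : (\int[cons_measure nu mu]_(u in S) (f u)%:E =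
    \int[(nu \x mu)%E]_(z in D `*` E) (f (cons_pair z))%:E)%E.
  rewrite -SDE (@integral_pushforward _ _ _ _ _ _
    (measurable_cons_pair (n := n)) (nu \x mu)%E S (EFin \o f)) //.
    exact/measurable_EFinP.
  by rewrite SDE.
(* Fubini is applied on the whole product, so the restriction to the rectangle becomes an extension
   by zero. *)
rewrite [X in fine X = _]integral_mkcond.
rewrite -integral21_prod_meas1; last first.
  exact/(integrable_mkcond _ mDE).
rewrite [in RHS]integral_mkcond; congr fine; apply: eq_integral => v _.
rewrite /fubini_G /patch; case: ifPn => [|/negP] vE.
  rewrite fineK; last first.
    by apply: integrable_fin_num => //; apply: fxint; rewrite inE in vE.
  rewrite [RHS]integral_mkcond; apply: eq_integral => x _.
  by rewrite /patch in_setX /= vE andbT.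
under eq_integral => x _ do rewrite in_setX /= (negbTE (introN idP vE)) andbF.
exact: integral0.
Qed.

End cons_fubini.

Section cubes.
Context (R : realType).

Lemma compact_cube n : compact (@cube R n).
Proof.
rewrite /cube; apply: (@rV_compact R n (fun=> `[0, 1]%classic)) => _.
exact: segment_compact.
Qed.

Definition row_of_tuple n (u : n.-tuple (measurableTypeR R)) : 'rV[R]_n :=
  \row_i (tnth u i : R).

Lemma measurable_cube_tuple n : measurable (@cube_tuple R n).
Proof.
have -> : @cube_tuple R n =
    \bigcap_(i in [set: 'I_n]) ((fun u => tnth u i) @^-1` `[0, 1]%classic).
  apply/seteqP; split => u /= cu; first by move=> i _; exact: cu.
  by move=> i; exact: (cu i).
apply: fin_bigcap_measurable => // i _.
by rewrite -[X in measurable X]setTI; exact: measurable_tnth.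
Qed.

Lemma cons_pair_cube_tuple n :
  @cons_pair _ (measurableTypeR R) n @^-1` (@cube_tuple R n.+1) =
  `[0, 1]%classic `*` @cube_tuple R n.
Proof.
apply/seteqP; split => -[x v] /=.
  move=> cu; split; first by have := cu ord0; rewrite tnth0.
  by move=> i; have := cu (lift ord0 i); rewrite tnthS.
by move=> [x01 vc] i; case: (unliftP ord0 i) => [j|] ->; rewrite ?tnth0 ?tnthS //.
Qed.

Lemma power_measure_cube_tuple n :
  (power_measure (@lebesgue_measure R) n (@cube_tuple R n) < +oo)%E.
Proof.
elim: n => [|n IH] /=; first by rewrite diracE; case: (_ \in _); rewrite ltry.
rewrite /cons_measure /pushforward cons_pair_cube_tuple product_measure1E //.
  by rewrite /= lebesgue_measure_itv /= lte01 sube0 mul1e.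
exact: measurable_cube_tuple.
Qed.

(* The sigma-algebra on tuples is generated by the coordinates while the
   topology is that of rows: an open set is a countable union of rational
   boxes. *)
Lemma measurable_row_of_tuple n (U : set 'rV[R]_n) : open U ->
  measurable (@row_of_tuple n @^-1` U).
Proof.
move=> oU.
pose box (c : 'rV[rat]_n * nat) : set 'rV[R]_n :=
  [set v | forall i, `|ratr (c.1 ord0 i) - v ord0 i| < c.2.+1%:R^-1].
(* Boxes that leave [U] are replaced by the empty set, so that the union runs over a full countable
   type. *)
have -> : @row_of_tuple n @^-1` U = \bigcup_(c in [set: 'rV[rat]_n * nat])
    (if pselect (box c `<=` U) then @row_of_tuple n @^-1` box c else set0).
  apply/seteqP; split => u /=; last first.
    by move=> [c _]; case: pselect => // cU; exact: cU.
  move=> Uu.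
  have /nbhs_ballP[e /= e0 eU] : nbhs (row_of_tuple u) U by exact: open_nbhs_nbhs.
  (* With radius below [e / 2], every point of a box that contains the given row is within [e] of
     that row. *)
  have [m _ /(_ m (leqnn m)) /= me] :=
    near_infty_natSinv_lt (PosNum (divr_gt0 e0 (ltr0Sn R 1))).
  have m0 : 0 < m.+1%:R^-1 :> R by rewrite invr_gt0.
  have qP i : exists q : rat, `|ratr q - (tnth u i : R)| < m.+1%:R^-1.
    have [q] : exists q : rat, ratr q \in
        `](tnth u i : R), (tnth u i : R) + m.+1%:R^-1[.
      by apply: rat_in_itvoo; rewrite ltrDl.
    rewrite in_itv /= => /andP[uq qu]; exists q.
    by rewrite ger0_norm ?subr_ge0 ?ltW // ltrBlDl.
  have [q qu] := choice qP.
  exists (\row_i q i, m) => //; case: pselect => [_ i|]; first by rewrite /= !mxE.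
  case=> v vbox; apply: eU; split => // i j; rewrite ord1 !mxE /ball /=.
  rewrite -(subrKA (ratr (q j))) (le_lt_trans (ler_normD _ _)) // (splitr e).
  apply: ltrD; first by rewrite distrC (lt_trans (qu j)).
  by have := vbox j; rewrite /= mxE => /lt_trans; exact.
apply: countable_bigcupT_measurable => // c.
case: pselect => [boxU|]; last by move=> ?; exact: measurable0.
have -> : @row_of_tuple n @^-1` box c = \bigcap_(i in [set: 'I_n])
    ((fun u => tnth u i) @^-1`
      [set x : R | `|ratr (c.1 ord0 i) - x| < c.2.+1%:R^-1]).
  apply/seteqP; split => u /= cu; first by move=> i _; have := cu i; rewrite mxE.
  by move=> i; rewrite mxE; exact: (cu i).
apply: fin_bigcap_measurable => // i _.
rewrite -[X in measurable X]setTI; apply: measurable_tnth => //.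
apply: open_measurable.
rewrite (_ : [set x | _] = ball (ratr (c.1 ord0 i) : R) c.2.+1%:R^-1) //.
exact: ball_open.
Qed.

Lemma measurable_fun_row_of_tuple n (f : 'rV[R]_n -> R) : continuous f ->
  measurable_fun setT (f \o @row_of_tuple n).
Proof.
move=> /continuousP cf; apply: (measurability _ (RGenOpens.measurableE R)).
move=> _ [_ [a [b ->] <-]]; rewrite setTI comp_preimage.
by apply: measurable_row_of_tuple; apply: cf; exact: interval_open.
Qed.

Lemma bounded_cube n (f : 'rV[R]_n -> R) : continuous f ->
  [bounded f x | x in cube n].
Proof.
move=> cf; have : compact (f @` cube n).
  by apply: continuous_compact; [exact: continuous_subspaceT|exact: compact_cube].
move=> /compact_bounded [M [Mr fM]]; exists M; split => // x Mx y cy.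
by apply: (fM x Mx); exists y.
Qed.

Lemma cube_row_of_tuple n (u : n.-tuple (measurableTypeR R)) :
  cube_tuple u -> cube n (row_of_tuple u).
Proof. by move=> cu i; rewrite mxE; exact: cu. Qed.

(** Fubini applies because a continuous function is bounded on the compact cube, and the cube has
    finite measure. *)
Lemma Rintegral_cube_recl n (f : 'rV[R]_n.+1 -> R) : continuous f ->
  \int[power_measure (@lebesgue_measure R) n.+1]_(u in @cube_tuple R n.+1)
    f (row_of_tuple u) =
  \int[power_measure (@lebesgue_measure R) n]_(v in @cube_tuple R n)
    \int[lebesgue_measure]_(x in `[0, 1]) f (row_of_tuple [tuple of x :: v]).
Proof.
move=> cf; have mf := measurable_fun_row_of_tuple cf.
have mc := @measurable_cube_tuple n.
apply: Rintegral_cons_measure => //.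
- exact: measurable_cube_tuple.
- exact: cons_pair_cube_tuple.
- apply: measurable_bounded_integrable => //.
  + exact: measurableX.
  + rewrite /= product_measure1E //= lebesgue_measure_itv /= lte01 sube0 mul1e.
    exact: power_measure_cube_tuple.
  + apply: measurable_funS measurableT _
      (measurableT_comp mf (measurable_cons_pair (n := n))) => //.
  + have [M [Mr fM]] := bounded_cube cf; exists M; split => // y My z.
    rewrite -cons_pair_cube_tuple => cz; apply: (fM y My).
    exact: cube_row_of_tuple.
- move=> v cv; apply: measurable_bounded_integrable => //.
  + by rewrite /= lebesgue_measure_itv /= lte01 ltry.
  + apply: (@measurable_funS _ _ _ _ setT) => //.
    apply: (measurableT_comp mf); apply: measurable_cons => //.
  + have [M [Mr fM]] := bounded_cube cf; exists M; split => // y My z cz.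
    apply: (fM y My); apply: cube_row_of_tuple.
    suff : (@cons_pair _ _ n @^-1` (@cube_tuple R n.+1)) (z, v) by [].
    by rewrite cons_pair_cube_tuple.
Qed.
End cubes.

(** * Rows and the retraction onto the cube *)

Section rows.
Context (R : realType).

(** Indexing by natural numbers allows rows whose lengths are equal but not convertible, such as
    [N - j] and [1 + (N - j.+1)], to be compared without casts. The default 0 lies in the unit
    interval, so membership in the cube and clamping are insensitive to it. *)
Definition entry n (v : 'rV[R]_n) (m : nat) : R := oapp (v ord0) 0 (insub m).

Lemma entry_ord n (v : 'rV[R]_n) (i : 'I_n) : entry v i = v ord0 i.
Proof. by rewrite /entry valK. Qed.

Lemma entry_default n (v : 'rV[R]_n) m : (n <= m)%N -> entry v m = 0.
Proof. by move=> nm; rewrite /entry insubF // ltnNge nm. Qed.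

Lemma entry_row n (F : nat -> R) m :
  entry (\row_(i < n) F i) m = if (m < n)%N then F m else 0.
Proof.
case: ltnP => mn; last exact: entry_default.
by rewrite (entry_ord _ (Ordinal mn)) mxE.
Qed.

Lemma eq_entry n (u v : 'rV[R]_n) : entry u =1 entry v -> u = v.
Proof. by move=> uv; apply/rowP => i; rewrite -!entry_ord uv. Qed.

Lemma entry_cat n p q (u : 'rV[R]_n) (v : 'rV[R]_p) m : (n + p = q)%N ->
  entry (cat_row q u v) m = if (m < n)%N then entry u m else entry v (m - n).
Proof.
move=> <-; rewrite /cat_row conform_mx_id.
case: ltnP => mn.
  rewrite (entry_ord u (Ordinal mn)).
  by rewrite (entry_ord _ (lshift p (Ordinal mn))) row_mxEl.
case: (ltnP m (n + p)) => mp; last first.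
  by rewrite !entry_default // leq_subRL.
have mnp : (m - n < p)%N by rewrite ltn_subLR.
rewrite (entry_ord v (Ordinal mnp)) -(row_mxEr u) -entry_ord /=.
by rewrite subnKC.
Qed.

(** A version of [drop_row] with both lengths free, so that successive drops compose without casts;
    meant for [q <= n]. *)
Definition last_row n q (k : 'rV[R]_n) : 'rV[R]_q :=
  \row_l entry k (n - q + l).

Lemma entry_last n q (k : 'rV[R]_n) m :
  entry (last_row q k) m = if (m < q)%N then entry k (n - q + m) else 0.
Proof. by rewrite (entry_row _ (fun l => entry k (n - q + l))). Qed.

Lemma drop_rowE N j (k : 'rV[R]_N) : (j <= N)%N ->
  drop_row j k = last_row (N - j) k.
Proof.
by move=> jN; apply/rowP => l; rewrite !mxE subKn // -entry_ord.
Qed.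

Lemma last_row_last n q r (k : 'rV[R]_n) : (r <= q)%N -> (q <= n)%N ->
  last_row r (last_row q k) = last_row r k.
Proof.
move=> rq qn; apply: eq_entry => m; rewrite !entry_last.
case: ltnP => // mr; rewrite ifT; last lia.
by congr entry; lia.
Qed.

Lemma last_row_id n (k : 'rV[R]_n) : last_row n k = k.
Proof.
apply: eq_entry => m; rewrite entry_last subnn add0n.
by case: ltnP => // nm; rewrite entry_default.
Qed.

Lemma last_row_cat n p q (u : 'rV[R]_n) (v : 'rV[R]_p) : (n + p = q)%N ->
  last_row p (cat_row q u v) = v.
Proof.
move=> npq; apply: eq_entry => m; rewrite entry_last entry_cat //.
case: ltnP => mp; last by rewrite entry_default.
by rewrite ifF; [congr entry; lia | lia].
Qed.

(** Between lengths that are equal but not convertible, [last_row] serves as the cast. *)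
Lemma last_row_cat_cast n p q q' (u : 'rV[R]_n) (v : 'rV[R]_p) :
  (n + p = q)%N -> q = q' -> last_row q' (cat_row q u v) = cat_row q' u v.
Proof. by move=> npq <-; exact: last_row_id. Qed.

Lemma cat_row0 q (u : 'rV[R]_0) (v : 'rV[R]_q) : cat_row q u v = v.
Proof. by apply: eq_entry => m; rewrite entry_cat // subn0. Qed.

Lemma cat_row_cons n p q (x : R) (u : n.-tuple (measurableTypeR R))
    (v : 'rV[R]_p) : (n + p = q)%N ->
  cat_row q.+1 (row_of_tuple [tuple of x :: u]) v =
  cat_row q.+1 (const_mx x : 'rV_1) (cat_row q (row_of_tuple u) v).
Proof.
move=> npq; apply: eq_entry => m; rewrite !entry_cat //; last lia.
case: m => [|m] /=.
  rewrite (entry_ord (row_of_tuple _) (Ordinal (ltn0Sn n))).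
  by rewrite (entry_ord (const_mx x) (Ordinal (ltn0Sn 0))) !mxE.
rewrite subn1 /= ltnS; case: ltnP => mn; last by rewrite subSS.
rewrite (entry_ord (row_of_tuple [tuple of x :: u]) (lift ord0 (Ordinal mn))).
by rewrite (entry_ord (row_of_tuple u) (Ordinal mn)) !mxE tnthS.
Qed.

Definition clamp1 (x : R) : R := Num.max 0 (Num.min 1 x).

Definition clamp n (v : 'rV[R]_n) : 'rV[R]_n := map_mx clamp1 v.

Lemma clamp1_id x : x \in `[0, 1] -> clamp1 x = x.
Proof.
by rewrite in_itv /= /clamp1 => /andP[x0 x1]; rewrite min_r // max_r.
Qed.

Lemma clamp1_itv x : clamp1 x \in `[0, 1].
Proof.
by rewrite in_itv /= /clamp1 le_max lexx ge_max ler01 ge_min lexx.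
Qed.

Lemma cube_clamp n (v : 'rV[R]_n) : cube n (clamp v).
Proof. by move=> i; rewrite mxE; exact: clamp1_itv. Qed.

Lemma clamp_id n (v : 'rV[R]_n) : cube n v -> clamp v = v.
Proof. by move=> cv; apply/rowP => i; rewrite mxE clamp1_id. Qed.

Lemma cubeP n (v : 'rV[R]_n) : cube n v <-> forall m, entry v m \in `[0, 1].
Proof.
split=> cv; last by move=> i; rewrite -entry_ord.
move=> m; case: (ltnP m n) => mn; first by rewrite (entry_ord v (Ordinal mn)).
by rewrite entry_default // in_itv /= lexx ler01.
Qed.

Lemma cube_cat n p q (u : 'rV[R]_n) (v : 'rV[R]_p) : (n + p = q)%N ->
  cube n u -> cube p v -> cube q (cat_row q u v).
Proof.
move=> npq /cubeP cu /cubeP cv; apply/cubeP => m.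
by rewrite entry_cat //; case: ifP.
Qed.

Lemma cube_last n q (k : 'rV[R]_n) : cube n k -> cube q (last_row q k).
Proof.
move=> /cubeP ck; apply/cubeP => m; rewrite entry_last; case: ifP => // _.
by rewrite in_itv /= lexx ler01.
Qed.

Lemma cube_const_mx (x : R) : x \in `[0, 1] -> cube 1 (const_mx x : 'rV_1).
Proof. by move=> x01 i; rewrite mxE. Qed.

Lemma continuous_clamp1 : continuous clamp1.
Proof.
move=> x; apply: (@continuous_max _ _ (fun=> 0)); first exact: cvg_cst.
by apply: (@continuous_min _ _ (fun=> 1)) => //; exact: cvg_cst.
Qed.

Lemma continuous_rowP (T : topologicalType) n (f : T -> 'rV[R]_n) :
  (forall m, continuous (fun x => entry (f x) m)) -> continuous f.
Proof.
move=> cf x W [P Pf sPW].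
have : \forall y \near x, forall i, P ord0 i (f y ord0 i).
  apply: filter_forall => i; have := cf i x (P ord0 i).
  under eq_fun do rewrite entry_ord.
  by rewrite entry_ord; apply; exact: Pf.
by apply: filterS => y Py; apply: sPW => i j; rewrite ord1.
Qed.

Lemma continuous_entry n m : continuous (fun v : 'rV[R]_n => entry v m).
Proof.
case: (ltnP m n) => mn; last first.
  under eq_fun do rewrite entry_default //.
  exact: cst_continuous.
under eq_fun do rewrite (entry_ord _ (Ordinal mn)).
exact: coord_continuous.
Qed.

Lemma continuous_clamp n : continuous (@clamp n).
Proof.
apply: continuous_rowP => m.
have -> : (fun v => entry (@clamp n v) m) = clamp1 \o (fun v => entry v m).
  apply/funext => v /=; rewrite /entry; case: insubP => [i _ _|_] /=.
    by rewrite mxE.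
  by rewrite clamp1_id // in_itv /= lexx ler01.
move=> v; apply: continuous_comp; first exact: continuous_entry.
exact: continuous_clamp1.
Qed.

Lemma continuous_last_row n q : continuous (@last_row n q).
Proof.
apply: continuous_rowP => m; under eq_fun do rewrite entry_last.
by case: (m < q)%N; [exact: continuous_entry|exact: cst_continuous].
Qed.

Lemma continuous_cat_row (T : topologicalType) n p q (f : T -> 'rV[R]_n)
    (g : T -> 'rV[R]_p) : (n + p = q)%N -> continuous f -> continuous g ->
  continuous (fun x => cat_row q (f x) (g x)).
Proof.
move=> npq cf cg; apply: continuous_rowP => m.
under eq_fun do rewrite entry_cat //.
case: (m < n)%N => x.
  exact: (continuous_comp (cf x) (@continuous_entry n m (f x))).
exact: (continuous_comp (cg x) (@continuous_entry p (m - n) (g x))).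
Qed.

Lemma continuous_const_mx : continuous (fun t : R => const_mx t : 'rV[R]_1).
Proof.
apply: continuous_rowP => m.
have -> : (fun t : R => entry (const_mx t : 'rV_1) m) =
    fun t => if (m < 1)%N then t else 0.
  apply/funext => t; case: ltnP => m1; last exact: entry_default.
  by rewrite (entry_ord _ (Ordinal m1)) mxE.
by case: (m < 1)%N => t; [exact: cvg_id|exact: cvg_cst].
Qed.

End rows.

(** * Continuity *)

Section matrix_continuity.
Context (K : numFieldType) (T : topologicalType).

Lemma continuous_bigprod (I : Type) (r : seq I) (F : I -> T -> K) :
  (forall i, continuous (F i)) -> continuous (fun x => \prod_(i <- r) F i x).
Proof.
move=> cF; elim: r => [|i r IH] x.
  by under eq_fun do rewrite big_nil; exact: cvg_cst.
under eq_fun do rewrite big_cons.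
exact: cvgM (cF i x) (IH x).
Qed.

Lemma continuous_bigsum (I : Type) (r : seq I) (F : I -> T -> K) :
  (forall i, continuous (F i)) -> continuous (fun x => \sum_(i <- r) F i x).
Proof.
move=> cF; elim: r => [|i r IH] x.
  by under eq_fun do rewrite big_nil; exact: cvg_cst.
under eq_fun do rewrite big_cons.
exact: cvgD (cF i x) (IH x).
Qed.

Definition entrywise_continuous m n (f : T -> 'M[K]_(m, n)) :=
  forall a b, continuous (fun x => f x a b : K).

Lemma entrywise_continuous_mul m n p (f : T -> 'M[K]_(m, n))
    (g : T -> 'M[K]_(n, p)) : entrywise_continuous f -> entrywise_continuous g ->
  entrywise_continuous (fun x => f x *m g x).
Proof.
move=> cf cg a b; under eq_fun do rewrite mxE.
apply: continuous_bigsum => i x; exact: cvgM (cf a i x) (cg i b x).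
Qed.

Lemma entrywise_continuous_add m n (f g : T -> 'M[K]_(m, n)) :
  entrywise_continuous f -> entrywise_continuous g ->
  entrywise_continuous (fun x => f x + g x).
Proof.
move=> cf cg a b x; under eq_fun do rewrite mxE.
exact: cvgD (cf a b x) (cg a b x).
Qed.

Lemma entrywise_continuous_cst m n (A : 'M[K]_(m, n)) :
  entrywise_continuous (fun=> A).
Proof. by move=> a b x; exact: cvg_cst. Qed.

Lemma continuous_det n (f : T -> 'M[K]_n) : entrywise_continuous f ->
  continuous (fun x => \det (f x)).
Proof.
move=> cf; rewrite /determinant; apply: continuous_bigsum => s x.
apply: cvgM; first exact: cvg_cst.
by apply: continuous_bigprod => i; exact: cf.
Qed.

(** By Cramer's rule each entry of the inverse is a cofactor divided by the determinant, and both
    are polynomials in the entries. *)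
Lemma entrywise_continuous_inv n (f : T -> 'M[K]_n) :
  entrywise_continuous f -> (forall x, f x \in unitmx) ->
  entrywise_continuous (fun x => invmx (f x)).
Proof.
move=> cf fu a b x; rewrite /invmx.
under eq_fun do rewrite fu !mxE /cofactor.
apply: cvgM; last (apply: cvgM; first exact: cvg_cst).
  apply: cvgV; last exact: continuous_det.
  by rewrite -unitfE; have := fu x; rewrite unitmxE.
apply: continuous_det => i j y; under eq_fun do rewrite !mxE.
exact: cf.
Qed.

End matrix_continuity.

Section complex_continuity.
Local Open Scope complex_scope.
Context (R : realType) (T : topologicalType).

(** Stating it over an abstract [numFieldType] fixes the topology on [R[i]] as the one given by its
    norm. *)
Definition scalar_continuous (K : numFieldType) (f : T -> K) := continuous f.

Lemma scalar_continuousP (K : numFieldType) (f : T -> K) :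
  scalar_continuous f <->
  forall x e, 0 < e -> \forall y \near x, `|f x - f y| < e.
Proof.
split=> [cf x e e0|cf x].
  by have /cvgrPdist_lt/(_ e e0) := cf x.
by apply/cvgrPdist_lt => e e0; exact: cf.
Qed.

Lemma continuous_Re (f : T -> R[i]) : scalar_continuous f ->
  continuous (fun x => complex.Re (f x)).
Proof.
move=> /scalar_continuousP cf x; apply/cvgrPdist_lt => e e0.
have := cf x e%:C; rewrite ltcR => /(_ e0); apply: filterS => y.
move/(le_lt_trans (normc_ge_Re _)); rewrite ltcR.
by case: (f x) => ? ?; case: (f y).
Qed.

Lemma normc_ge_Im (x : R[i]) : `|complex.Im x|%:C <= `|x|.
Proof.
case: x => a b; rewrite normc_def /= lecR -(sqrtr_sqr b).
by rewrite ler_wsqrtr // lerDr sqr_ge0.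
Qed.

Lemma continuous_Im (f : T -> R[i]) : scalar_continuous f ->
  continuous (fun x => complex.Im (f x)).
Proof.
move=> /scalar_continuousP cf x; apply/cvgrPdist_lt => e e0.
have := cf x e%:C; rewrite ltcR => /(_ e0); apply: filterS => y.
move/(le_lt_trans (normc_ge_Im _)); rewrite ltcR.
by case: (f x) => ? ?; case: (f y).
Qed.

Lemma continuous_Complex (u v : T -> R) : continuous u -> continuous v ->
  scalar_continuous (fun x => Complex (u x) (v x)).
Proof.
move=> cu cv; apply/scalar_continuousP => x [e e'].
(* A positive complex number is real, so the tolerance reduces to its real part. *)
rewrite ltcE /= => /andP[/eqP-> {e'} e0].
have e20 : 0 < e / 2 by rewrite divr_gt0.
have /cvgrPdist_lt/(_ _ e20) nu := cu x.
have /cvgrPdist_lt/(_ _ e20) nv := cv x.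
near=> y.
have nuy : `|u x - u y| < e / 2 by near: y.
have nvy : `|v x - v y| < e / 2 by near: y.
rewrite normc_def /= -[X in _ < X]/(e%:C) ltcR.
(* The modulus is at most the sum of the absolute values of the two parts: after squaring, the two
   sides differ by a nonnegative cross term. *)
apply: (@le_lt_trans _ _ (`|u x - u y| + `|v x - v y|)); last first.
  by rewrite (splitr e) ltrD.
rewrite -[leRHS]ger0_norm ?addr_ge0 // -sqrtr_sqr ler_wsqrtr //.
by rewrite [leRHS]sqrrD !real_normK ?num_real // lerD2r lerDl mulrn_wge0 //.
Unshelve. all: by end_near. Qed.

End complex_continuity.

Section integral_continuity.
Context (R : realType).

Lemma integrable_continuous01 (f : R -> R) : continuous f ->
  lebesgue_measure.-integrable `[0, 1]%classic (EFin \o f).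
Proof.
move=> cf; apply: continuous_compact_integrable; first exact: segment_compact.
by apply: continuous_subspaceT => x; exact: cf.
Qed.

(** Compactness of the interval makes the continuity in [x] uniform in [t]: for [y] near [x] the
    integrands differ by at most [e] at every [t]. As the interval has length 1, so do the
    integrals. *)
Lemma continuous_Rintegral_param (T : topologicalType) (h : R -> T -> R) :
  continuous (fun z : R * T => h z.1 z.2) ->
  continuous (fun x => \int[@lebesgue_measure R]_(t in `[0, 1]) h t x).
Proof.
move=> ch.
have chx x : continuous (h ^~ x).
  move=> t; have c1 : (s, x) @[s --> t] --> (t, x).
    by apply (cvg_pair (f := fun s => s)); [exact: cvg_id|exact: cvg_cst].
  exact: (continuous_comp c1 (ch (t, x))).
move=> x; apply/cvgrPdist_le => e e0.
have e20 : 0 < e / 2 by rewrite divr_gt0.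
have : \forall y \near x, `[0, 1]%classic `<=` [set t | `|h t x - h t y| <= e].
  have /compact_near_coveringP K := @segment_compact R 0 1.
  apply: (K T (nbhs x) (fun y t => `|h t x - h t y| <= e)) => t _.
  have /cvgrPdist_lt/(_ _ e20)[[U V] /= [tU xV] UVh] := ch (t, x).
  have /cvgrPdist_lt/(_ _ e20) nt := chx x t.
  (* For [t'] and [y] in these neighbourhoods, [h t' x] and [h t' y] are both within [e / 2] of
     [h t x]. *)
  exists (U `&` [set t' | `|h t x - h t' x| < e / 2], V).
    by split => //; exact: filterI.
  move=> [t' y] /= [[Ut' n2] Vy].
  have n1 : `|h t x - h t' y| < e / 2 by exact: (UVh (t', y)).
  rewrite ltW // -(subrKA (h t x)) (le_lt_trans (ler_normD _ _)) // (splitr e).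
  by rewrite ltrD // distrC.
apply: filterS => y hy.
rewrite -RintegralB //; [|exact: integrable_continuous01..].
have iB : lebesgue_measure.-integrable `[0, 1]%classic
    (EFin \o (fun t => h t x - h t y)).
  by apply: integrable_continuous01 => t; exact: cvgB (chx x t) (chx y t).
rewrite (le_trans (le_normr_Rintegral _ iB)) //.
have ic : lebesgue_measure.-integrable `[0, 1]%classic
    (EFin \o (fun=> e) : R -> \bar R).
  by apply: integrable_continuous01; exact: cst_continuous.
apply: (@le_trans _ _ (\int[@lebesgue_measure R]_(t in `[0, 1]) (fun=> e) t)).
  by apply: le_Rintegral => //; exact: (integrable_norm iB).
rewrite Rintegral_cst // /= lebesgue_measure_itv /= lte01 sube0 /= mulr1.
exact: lexx.
Qed.

End integral_continuity.

(** * Matrix integrals *)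

Lemma invmx_mul (K : comUnitRingType) n (A B : 'M[K]_n) :
  A \in unitmx -> B \in unitmx -> invmx (A *m B) = invmx B *m invmx A.
Proof.
move=> uA uB; have uAB : A *m B \in unitmx by rewrite unitmx_mul uA.
apply: (can_inj (mulKmx uAB)); rewrite mulmxV //.
by rewrite mulmxA mulmxK // mulmxV.
Qed.

Section integrals01.
Context (R : realType).
Local Notation C := R[i].
Local Notation leb := (@lebesgue_measure R).

Lemma eq_matrix_integral d (T : measurableType d) (mu : {measure set T -> \bar R})
    (D : set T) M (f g : T -> 'M[C]_M) : (forall x, D x -> f x = g x) ->
  matrix_integral mu D f = matrix_integral mu D g.
Proof.
move=> fg; apply/matrixP => a b; rewrite !mxE /complex_integral.
by congr Complex; apply: eq_Rintegral => x /[!inE] /fg ->.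
Qed.

Lemma complex_integralD (f g : R -> C) :
  scalar_continuous f -> scalar_continuous g ->
  complex_integral leb `[0, 1] (fun t => f t + g t) =
  complex_integral leb `[0, 1] f + complex_integral leb `[0, 1] g.
Proof.
move=> cf cg; rewrite /complex_integral.
apply/eqP; rewrite eq_complex /=; apply/andP; split; apply/eqP.
  rewrite -RintegralD //; last 2 first.
  - by apply: integrable_continuous01; exact: continuous_Re.
  - by apply: integrable_continuous01; exact: continuous_Re.
  by apply: eq_Rintegral => t _; case: (f t) (g t) => [? ?] [? ?].
rewrite -RintegralD //; last 2 first.
- by apply: integrable_continuous01; exact: continuous_Im.
- by apply: integrable_continuous01; exact: continuous_Im.
by apply: eq_Rintegral => t _; case: (f t) (g t) => [? ?] [? ?].
Qed.

Lemma complex_integralZ (c : C) (f : R -> C) : scalar_continuous f ->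
  complex_integral leb `[0, 1] (fun t => c * f t) =
  c * complex_integral leb `[0, 1] f.
Proof.
move=> cf; rewrite /complex_integral; case: c => a b.
have iR := integrable_continuous01 (continuous_Re cf).
have iI := integrable_continuous01 (continuous_Im cf).
have iZ (r : R) (g : R -> R) : leb.-integrable `[0, 1] (EFin \o g) ->
    leb.-integrable `[0, 1] (EFin \o (fun t => r * g t)).
  by move=> ig; have := @integrableZl _ _ _ leb `[0, 1]%classic _ r _ ig; apply.
apply/eqP; rewrite eq_complex /=; apply/andP; split; apply/eqP.
  rewrite -!RintegralZl // -RintegralB //; [|exact: iZ..].
  by apply: eq_Rintegral => t _; case: (f t).
rewrite -!RintegralZl // -RintegralD //; [|exact: iZ..].
by apply: eq_Rintegral => t _; case: (f t).
Qed.

Lemma complex_integral0 : complex_integral leb `[0, 1] (fun=> 0 : C) = 0.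
Proof.
transitivity (complex_integral leb `[0, 1] (fun=> (0 : C) * 0)).
  by congr complex_integral; apply/funext => t; rewrite mul0r.
by rewrite (@complex_integralZ 0 (fun=> 0)) ?[LHS]mul0r //; exact: cst_continuous.
Qed.

(** The constant factor is on the left because [(F_i T)^-1 = T^-1 F_i^-1], where only [F_i] depends
    on the integrated variable. *)
Lemma matrix_integral_mull M (B : 'M[C]_M) (X : R -> 'M[C]_M) :
  entrywise_continuous X ->
  matrix_integral leb `[0, 1] (fun t => B *m X t) =
  B *m matrix_integral leb `[0, 1] X.
Proof.
move=> cX; apply/matrixP => a b; rewrite !mxE.
transitivity (complex_integral leb `[0, 1] (fun t => \sum_c B a c * X t c b)).
  by congr complex_integral; apply/funext => t; rewrite mxE.
rewrite (eq_bigr (fun c =>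
  complex_integral leb `[0, 1] (fun t => B a c * X t c b))); last first.
  by move=> c _; rewrite mxE complex_integralZ //; exact: cX.
have cBX c : scalar_continuous (fun t => B a c * X t c b).
  by move=> t; exact: cvgM (cvg_cst _) (cX c b t).
(* Induction over the list of summation indices reduces the finite sum to additivity for two
   terms. *)
elim: (index_enum _) => [|c r IH].
  rewrite big_nil -[RHS]complex_integral0; congr complex_integral.
  by apply/funext => t; rewrite big_nil.
rewrite big_cons -IH -complex_integralD //; last exact: continuous_bigsum.
by congr complex_integral; apply/funext => t; rewrite big_cons.
Qed.

End integrals01.

(** * Continuity on the cube and integration of leading variables *)

Section cube_continuity.
Context (R : realType).
Local Notation C := R[i].

(* Composing with [clamp] turns continuity on the cube into continuity on the
   whole space without changing any integral over the cube. *)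
Definition cube_continuous n m p (f : 'rV[R]_n -> 'M[C]_(m, p)) :=
  entrywise_continuous (fun k => f (clamp k)).

(** Since [clamp] is continuous with values in the cube, it converges within the cube, which is all
    that continuity relative to the cube requires. *)
Lemma within_cube_continuous n M (f : 'rV[R]_n -> 'M[C]_M) :
  {within cube n, continuous (f : 'rV[R]_n -> 'M[C^o]_M)} -> cube_continuous f.
Proof.
move=> /subspace_continuousP cf a b k.
have := cf (clamp k) (cube_clamp k) => fk.
have ck : clamp x @[x --> k] --> within (cube n) (nbhs (clamp k)).
  move=> W /(@continuous_clamp R n k) nW.
  have {}nW : \forall x \near k, cube n (clamp x) -> W (clamp x) by exact: nW.
  apply: filterS nW => x.
  by apply; exact: cube_clamp.
have := cvg_comp _ _ ck fk => ffk.
have := cvg_comp _ _ ffk (@coord_continuous C M M a b (f (clamp k))).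
exact.
Qed.

Lemma clamp_last n q (k : 'rV[R]_n) : clamp (last_row q k) = last_row q (clamp k).
Proof.
apply/rowP => l; rewrite !mxE /entry; case: insubP => [i _ _|_] /=.
  by rewrite mxE.
by rewrite clamp1_id // in_itv /= lexx ler01.
Qed.

Lemma cube_continuous_last n q m p (f : 'rV[R]_q -> 'M[C]_(m, p)) :
  cube_continuous f -> cube_continuous (fun k : 'rV[R]_n => f (last_row q k)).
Proof.
move=> cf a b k; under eq_fun do rewrite -clamp_last.
exact: (continuous_comp (@continuous_last_row R n q k) (cf a b (last_row q k))).
Qed.

Lemma cube_continuous_cat (T : topologicalType) n p q M (f : 'rV[R]_q -> 'M[C]_M)
    (u : T -> 'rV[R]_n) (v : T -> 'rV[R]_p) : (n + p = q)%N ->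
  cube_continuous f -> continuous u -> continuous v ->
  entrywise_continuous (fun x => f (clamp (cat_row q (u x) (v x)))).
Proof.
move=> npq cf cu cv a b x.
have := continuous_cat_row npq cu cv.
move=> /(_ x) cx.
exact: (continuous_comp cx (cf a b _)).
Qed.

Lemma cube_continuous_mul n m p q (f : 'rV[R]_n -> 'M[C]_(m, p))
    (g : 'rV[R]_n -> 'M[C]_(p, q)) :
  cube_continuous f -> cube_continuous g -> cube_continuous (fun k => f k *m g k).
Proof. exact: entrywise_continuous_mul. Qed.

Lemma cube_continuous_inv n M (f : 'rV[R]_n -> 'M[C]_M) :
  cube_continuous f -> (forall k, cube n k -> f k \in unitmx) ->
  cube_continuous (fun k => invmx (f k)).
Proof.
move=> cf uf; apply: entrywise_continuous_inv cf _ => k; apply: uf.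
exact: cube_clamp.
Qed.

(** [int_slice] and [int_front] are [int_next] and [int_first] with the row lengths as free
    parameters, so that an induction can vary them. *)
Definition int_slice M q r (g : 'rV[R]_q -> 'M[C]_M) (k : 'rV[R]_r) : 'M[C]_M :=
  matrix_integral (@lebesgue_measure R) `[0, 1]
    (fun t : measurableTypeR R => g (cat_row q (const_mx t : 'rV_1) k)).

Definition int_front M p q r (g : 'rV[R]_q -> 'M[C]_M) (k : 'rV[R]_r) : 'M[C]_M :=
  matrix_integral (power_measure (@lebesgue_measure R) p) (@cube_tuple R p)
    (fun u => g (cat_row q (row_of_tuple u) k)).

(** Clamping the concatenated row makes the integrand jointly continuous in [t] and [k] without
    changing it for [t] in the unit interval; the result on parameter integrals then applies to the
    real and imaginary parts. *)
Lemma cube_continuous_slice M q r (g : 'rV[R]_q -> 'M[C]_M) : (1 + r = q)%N ->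
  cube_continuous g -> cube_continuous (int_slice (r := r) g).
Proof.
move=> rq cg a b.
pose h (z : R * 'rV[R]_r) :=
  g (clamp (cat_row q (const_mx z.1 : 'rV_1) (clamp z.2))).
have ch : entrywise_continuous h.
  apply: cube_continuous_cat => // z.
    have c1 : z'.1 @[z' --> z] --> z.1 by exact: cvg_fst.
    exact: (continuous_comp c1 (@continuous_const_mx R z.1)).
  have c2 : z'.2 @[z' --> z] --> z.2 by exact: cvg_snd.
  exact: (continuous_comp c2 (@continuous_clamp R r z.2)).
have -> : (fun k : 'rV[R]_r => int_slice g (clamp k) a b) = fun k => Complex
   (\int[@lebesgue_measure R]_(t in `[0, 1])
      complex.Re (h (t, k) a b))
   (\int[@lebesgue_measure R]_(t in `[0, 1])
      complex.Im (h (t, k) a b)).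
  apply/funext => k; rewrite mxE /complex_integral.
  congr Complex; apply: eq_Rintegral => t /[!inE] /= t01; rewrite /h /=;
    rewrite [clamp (cat_row _ _ _)]clamp_id //.
    by apply: cube_cat => //; [exact: cube_const_mx|exact: cube_clamp].
  by apply: cube_cat => //; [exact: cube_const_mx|exact: cube_clamp].
apply: continuous_Complex.
  exact: (continuous_Rintegral_param (h := fun t k => complex.Re (h (t, k) a b))
    (continuous_Re (ch a b))).
exact: (continuous_Rintegral_param (h := fun t k => complex.Im (h (t, k) a b))
    (continuous_Im (ch a b))).
Qed.

(** With no variable left, the measure is the Dirac mass at the empty tuple, which belongs to the
    zero-dimensional cube. *)
Lemma int_front0 M q (g : 'rV[R]_q -> 'M[C]_M) k : int_front 0 g k = g k.
Proof.
apply/matrixP => a b; rewrite mxE /complex_integral.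
have E (f : 0.-tuple (measurableTypeR R) -> R) :
    \int[power_measure (@lebesgue_measure R) 0]_(u in @cube_tuple R 0) f u =
    f [tuple].
  rewrite (_ : f = fun=> f [tuple]); last first.
    by apply/funext => u; rewrite (tuple0 u).
  rewrite Rintegral_cst; last exact: measurable_cube_tuple.
  have D1 : power_measure (@lebesgue_measure R) 0 (@cube_tuple R 0) = 1%E.
    by rewrite /= diracE mem_set // => -[].
  by rewrite [X in fine X]D1 mulr1.
by rewrite !E cat_row0; case: (g k a b).
Qed.

Lemma int_front_recl M p q r s (g : 'rV[R]_q -> 'M[C]_M) (k : 'rV[R]_r) :
  (1 + s = q)%N -> (p + r = s)%N -> cube_continuous g -> cube r k ->
  int_front p.+1 g k = int_front p (int_slice (r := s) g) k.
Proof.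
move=> sq ps cg ck; rewrite -sq in g cg *.
(* [Rintegral_cube_recl] wants continuity on the whole space, hence the clamped integrand; both
   sides only evaluate it on the cube, where clamping does nothing. *)
pose h (v : 'rV[R]_p.+1) := g (clamp (cat_row (1 + s) v k)).
have ch : entrywise_continuous h.
  apply: cube_continuous_cat => //; first by rewrite -ps.
    by move=> v; exact: cvg_id.
  exact: cst_continuous.
have E u : cube_tuple u -> g (cat_row (1 + s) (row_of_tuple u) k) =
    g (clamp (cat_row (1 + s) (@row_of_tuple R p.+1 u) k)).
  move=> cu; rewrite clamp_id //; apply: cube_cat => //; first by rewrite -ps.
  exact: cube_row_of_tuple.
rewrite /int_front (eq_matrix_integral _ E).
have E' (v : p.-tuple (measurableTypeR R)) x : cube_tuple v -> x \in `[0, 1] ->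
   g (cat_row (1 + s) (const_mx x : 'rV_1) (cat_row s (row_of_tuple v) k)) =
   g (clamp (cat_row (1 + s) (row_of_tuple [tuple of x :: v]) k)).
  move=> cv x01; rewrite cat_row_cons // clamp_id //.
  apply: cube_cat => //; first exact: cube_const_mx.
  by apply: cube_cat => //; exact: cube_row_of_tuple.
apply/matrixP => a b; rewrite !mxE /complex_integral; congr Complex.
  rewrite (Rintegral_cube_recl (f := fun v => complex.Re (h v a b))); last first.
    by apply: continuous_Re; exact: ch.
  apply: eq_Rintegral => v /[!inE] cv; rewrite mxE /=.
  by apply: eq_Rintegral => x /[!inE] x01; rewrite E'.
rewrite (Rintegral_cube_recl (f := fun v => complex.Im (h v a b))); last first.
  by apply: continuous_Im; exact: ch.
apply: eq_Rintegral => v /[!inE] cv; rewrite mxE /=.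
by apply: eq_Rintegral => x /[!inE] x01; rewrite E'.
Qed.

End cube_continuity.

(** * Integrating out the variables one by one *)

Section telescoping.
Context (R : realType) (N M : nat).
Local Notation C := R[i].
Variables (A : forall j, 'rV[R]_(N - j) -> 'M[C]_M) (lambda : C).
Hypothesis A_continuous : forall j, (j <= N)%N -> cube_continuous (@A j).
Hypothesis inv_exist : inverses_exist A lambda.

Local Notation F := (Fseq A lambda).
Local Notation G := (Gseq A lambda).
Local Notation intF j := (@int_next R N M j (fun k' => invmx (F j k'))).

Lemma F_unit j k : (j < N)%N -> cube (N - j) k -> F j k \in unitmx.
Proof. by move=> /inv_exist[+ _]; exact. Qed.

Lemma intF_unit j k : (j < N)%N -> cube (N - j.+1) k -> intF j k \in unitmx.
Proof. by move=> /inv_exist[_]; exact. Qed.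

(** Induction along the recursion: integrating out a variable preserves continuity, and so does
    inversion, since the matrices are invertible all over the cube. *)
Lemma F_continuous j : (j < N)%N -> cube_continuous (F j).
Proof.
elim: j => [|j IH] jN /=; apply: entrywise_continuous_add.
- exact: A_continuous.
- exact: entrywise_continuous_cst.
- by apply: A_continuous; exact: ltnW.
have intF_cont : cube_continuous (intF j).
  apply: cube_continuous_slice; first lia.
  apply: cube_continuous_inv => [|k ck]; first by apply: IH; lia.
  by apply: F_unit => //; lia.
by apply: cube_continuous_inv intF_cont _ => k; apply: intF_unit; lia.
Qed.

Lemma invF_continuous j : (j < N)%N -> cube_continuous (fun k => invmx (F j k)).
Proof.
by move=> jN; apply: cube_continuous_inv (F_continuous jN) _ => k; exact: F_unit.
Qed.

Lemma G_unit j k : (j < N)%N -> cube (N - j) k -> G j k \in unitmx.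
Proof.
case: j k => [|j] k jN ck; first exact: F_unit.
by rewrite unitmx_mul intF_unit ?F_unit //; lia.
Qed.

Lemma G_continuous j : (j < N)%N -> cube_continuous (G j).
Proof.
case: j => [|j] jN; first exact: F_continuous.
apply: cube_continuous_mul; last exact: F_continuous.
apply: cube_continuous_slice; first lia.
by apply: invF_continuous; lia.
Qed.

(** This is [G_i G_(i+1) ... G_(i+p-1)] as a function of [k_i] alone. Each recursive call forgets
    one variable, in the order in which the variables are integrated out. *)
Fixpoint tailG p i : 'rV[R]_(N - i) -> 'M[C]_M :=
  match p with
  | 0 => fun=> 1%:M
  | p'.+1 => fun k => G i k *m tailG p' (last_row (N - i.+1) k)
  end.

Lemma tailG_unit p i k : (i + p <= N)%N -> cube (N - i) k ->
  tailG p k \in unitmx.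
Proof.
elim: p i k => [|p IH] i k ipN ck /=; first exact: unitmx1.
by rewrite unitmx_mul G_unit ?IH //; [lia|exact: cube_last|lia].
Qed.

Lemma tailG_continuous p i : (i + p <= N)%N -> cube_continuous (@tailG p i).
Proof.
elim: p i => [|p IH] i ipN /=; first exact: entrywise_continuous_cst.
apply: cube_continuous_mul; first by apply: G_continuous; lia.
by apply: cube_continuous_last; apply: IH; lia.
Qed.

(** This is [F_i G_(i+1) ... G_(i+p)], the form whose inverse keeps its shape when [k_(i+1)] is
    integrated out. At [i = 0] it is [G_0 ... G_p], because [G_0 = F_0]. *)
Definition FG p i (k : 'rV[R]_(N - i)) : 'M[C]_M :=
  F i k *m tailG p (last_row (N - i.+1) k).

Lemma FG_unit p i k : (i + p < N)%N -> cube (N - i) k -> FG p k \in unitmx.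
Proof.
move=> ipN ck; have iN : (i < N)%N by lia.
by rewrite unitmx_mul F_unit ?tailG_unit //; first [exact: cube_last|lia].
Qed.

Lemma FG_continuous p i : (i + p < N)%N -> cube_continuous (@FG p i).
Proof.
move=> ipN; apply: cube_continuous_mul; first by apply: F_continuous; lia.
by apply: cube_continuous_last; apply: tailG_continuous; lia.
Qed.

(* [<(F_i G_(i+1) H)^-1> = H^-1 G_(i+1)^-1 <F_i^-1>], and
   [G_(i+1)^-1 <F_i^-1> = F_(i+1)^-1] by the definition of [G_(i+1)]. *)
Lemma int_slice_FG p i k : (i + p.+1 < N)%N -> cube (N - i.+1) k ->
  int_slice (fun k' => invmx (@FG p.+1 i k')) k = invmx (@FG p i.+1 k).
Proof.
move=> ipN ck; have iN : (1 + (N - i.+1) = N - i)%N by lia.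
(* The clamp makes [X] continuous on the whole line, as [matrix_integral_mull] requires; it is
   removed again on the unit interval. *)
pose X t := invmx (F i (clamp (cat_row (N - i) (const_mx t : 'rV_1) k))).
have cat_cube t : t \in `[0, 1] ->
    cube (N - i) (cat_row (N - i) (const_mx t : 'rV[R]_1) k).
  by move=> t01; apply: cube_cat => //; exact: cube_const_mx.
have uT : tailG p.+1 k \in unitmx by rewrite tailG_unit //; lia.
have -> : int_slice (fun k' => invmx (@FG p.+1 i k')) k =
    matrix_integral (@lebesgue_measure R) `[0, 1]
      (fun t => invmx (tailG p.+1 k) *m X t).
  apply: eq_matrix_integral => t t01.
  rewrite /FG last_row_cat // invmx_mul //; last first.
    by apply: F_unit; [lia|exact: cat_cube].
  by rewrite /X clamp_id //; exact: cat_cube.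
rewrite matrix_integral_mull; last first.
  apply: (@cube_continuous_cat _ _ 1 _ _ _ (fun k' => invmx (F i k'))) => //.
  - by apply: invF_continuous; lia.
  - exact: continuous_const_mx.
  - exact: cst_continuous.
have -> : matrix_integral (@lebesgue_measure R) `[0, 1] X = intF i k.
  by apply: eq_matrix_integral => t t01; rewrite /X clamp_id //; exact: cat_cube.
have uI : intF i k \in unitmx by apply: intF_unit => //; lia.
have uF : F i.+1 k \in unitmx by apply: F_unit => //; lia.
have uT' : tailG p (last_row (N - i.+2) k) \in unitmx.
  by apply: tailG_unit; [lia|exact: cube_last].
have uG : intF i k *m F i.+1 k \in unitmx by rewrite unitmx_mul uI.
(* With [G_(i+1)] unfolded, the inverse of the product ends in [<F_i^-1>^-1], which cancels against
   the integral [<F_i^-1>] on its right. *)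
rewrite -[tailG p.+1 k]/
  ((intF i k *m F i.+1 k) *m tailG p (last_row (N - i.+2) k)).
by rewrite /FG !invmx_mul // -!mulmxA mulVmx // mulmx1.
Qed.

(** Induction on [p] with [j] fixed: each integration raises [i] by one and absorbs one factor [G],
    until only [F_j^-1] and the variable [k_(j+1)] remain. *)
Lemma int_front_FG p i j k : (i + p)%N = j -> (j < N)%N -> cube (N - j.+1) k ->
  int_front p.+1 (fun k' => invmx (@FG p i k')) k = intF j k.
Proof.
elim: p i => [|p IH] i ipj jN ck;
  rewrite (@int_front_recl _ _ _ _ _ (N - i.+1)%N) //; try lia.
- have {ipj} ij : i = j by lia.
  subst j; rewrite int_front0.
  by apply: eq_matrix_integral => t _; rewrite /FG mulmx1.
- apply: cube_continuous_inv; first by apply: FG_continuous; lia.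
  by move=> k' ck'; apply: FG_unit => //; lia.
- rewrite -(IH i.+1) //; last lia.
  apply: eq_matrix_integral => u cu; rewrite int_slice_FG //; first lia.
  by apply: cube_cat; [lia|exact: cube_row_of_tuple|].
- apply: cube_continuous_inv; first by apply: FG_continuous; lia.
  by move=> k' ck'; apply: FG_unit => //; lia.
Qed.

Lemma prodGE j k : (j < N)%N -> prodG A lambda j.+1 k = FG j (drop_row 0 k).
Proof.
move=> jN; pose H l := G l (last_row (N - l) k).
have tailE p i : (i + p <= N)%N ->
    tailG p (last_row (N - i) k) = \big[mulmx/1%:M]_(l < p) H (i + l)%N.
  elim: p i => [|p IH] i ipN /=; first by rewrite big_ord0.
  rewrite big_ord_recl addn0; congr (_ *m _).
  rewrite last_row_last ?IH; try lia.
  by apply: eq_bigr => l _; rewrite addSnnS.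
(* The conversion uses [G_0 = F_0]; [drop_row 0] only changes the length from [N] to [N - 0]. *)
rewrite /prodG -[RHS]/(tailG j.+1 (drop_row 0 k)) drop_rowE // tailE //.
by apply: eq_bigr => l _; rewrite drop_rowE //; have := ltn_ord l; lia.
Qed.

Lemma cube_drop j (k : 'rV[R]_N) : cube N k -> cube (N - j) (drop_row j k).
Proof. by move=> ck i; rewrite mxE; exact: ck. Qed.

(** The case [i = 0] of [int_front_FG]. The product has [j.+1] factors, [G_0] to [G_j], and the
    integral runs over as many variables. *)
Lemma int_first_prodG j k : (j < N)%N -> cube (N - j.+1) k ->
  int_first (fun k' => invmx (prodG A lambda j.+1 k')) k = intF j k.
Proof.
move=> jN ck.
transitivity (int_front j.+1 (fun k' => invmx (@FG j 0 k')) k); last first.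
  exact: int_front_FG.
apply: eq_matrix_integral => u _.
(* The two sides concatenate into rows of length [N] and [N - 0], and [last_row] mediates between
   them. *)
rewrite prodGE // drop_rowE // last_row_cat_cast //; first lia.
by rewrite subn0.
Qed.

End telescoping.

(** * The formulas for the [A_j] *)

Unset Implicit Arguments.

Theorem theorem1p3 (R : realType) (N M : nat) (hN : (1 <= N)%N) (hM : (1 <= M)%N)
    (A : forall j : nat, 'rV[R]_(N - j) -> 'M[R[i]]_M)
    (hA : forall j : nat, (j <= N)%N ->
      {within cube (N - j),
        continuous (A j : 'rV[R]_(N - j) -> 'M[R[i]^o]_M)})
    (lambda : R[i]) (hinv : inverses_exist A lambda) :
  [/\ forall k : 'rV[R]_(N - 0), cube (N - 0) k ->
        A 0%N k = lambda%:M + Gseq A lambda 0 k,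
      forall j : nat, (j < N)%N ->
        [/\ forall k : 'rV[R]_N, cube N k -> prodG A lambda j.+1 k \in unitmx,
            forall k : 'rV[R]_(N - j.+1), cube (N - j.+1) k ->
              int_first (fun k' => invmx (prodG A lambda j.+1 k')) k \in unitmx
          & forall k : 'rV[R]_(N - j.+1), cube (N - j.+1) k ->
              A j.+1 k =
              invmx (int_first (fun k' => invmx (prodG A lambda j.+1 k')) k)
              *m (Gseq A lambda j.+1 k - 1%:M)],
      forall k : 'rV[R]_(N - 0), cube (N - 0) k ->
        A 0%N k = lambda%:M + Fseq A lambda 0 k
    & forall j : nat, (j < N)%N ->
        forall k : 'rV[R]_(N - j.+1), cube (N - j.+1) k ->
        A j.+1 k = Fseq A lambda j.+1 k -
          invmx (int_next (fun k' => invmx (Fseq A lambda j k')) k)].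
Proof.
have cA j : (j <= N)%N -> cube_continuous (A j).
  by move=> /hA; exact: within_cube_continuous.
split.
- by move=> k _ /=; rewrite addrC subrK.
- move=> j jN; split => [k ck|k ck|k ck].
  + by rewrite prodGE //; apply: FG_unit => //; exact: cube_drop.
  + by rewrite int_first_prodG //; exact: intF_unit.
  + have uI := intF_unit hinv jN ck.
    (* Writing [B] for the integral of [F_j^-1], the second form of [G_(j+1)] gives
       [G_(j+1) - I = B A_(j+1)], and [B^-1] cancels [B]. *)
    by rewrite int_first_prodG // GseqS_alt // [_ + _ - _]addrC addKr mulKmx.
- by move=> k _ /=; rewrite addrC subrK.
- by move=> j jN k _ /=; rewrite addrK.
Qed.
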